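(* Suppose $\{u_i^k,v_i^k\mid 1\le i\le M,\ 0\le k\le N\}$ is the solution of the compact difference scheme given in the context. Then $$\frac12(\|u^1\|^2+\|u^0\|^2)+\frac\mu2\Big[(|u^1|_1^2+|u^0|_1^2)+\frac{h^2}{12}(\|v^1\|^2+\|v^0\|^2)-\frac{h^4}{144}(|v^1|_1^2+|v^0|_1^2)\Big]+\nu\tau\Big(|u^{1/2}|_1^2+\frac{h^2}{12}\|v^{1/2}\|^2-\frac{h^4}{144}|v^{1/2}|_1^2\Big)$$ $$=\|u^0\|^2+\mu|u^0|_1^2+\frac{\mu h^2}{12}\|v^0\|^2-\frac{\mu h^4}{144}|v^0|_1^2,$$ and $$E(u^{k+1},u^k)=E(u^1,u^0),\qquad 1\le k\le N-1,$$ where $$E(u^{k+1},u^k)=\frac12(\|u^{k+1}\|^2+\|u^k\|^2)+2\nu\tau\sum_{l=1}^k\Big(|u^{\bar l}|_1^2+\frac{h^2}{12}\|v^{\bar l}\|^2-\frac{h^4}{144}|v^{\bar l}|_1^2\Big)$$ $$\qquad+\frac\mu2\Big[(|u^{k+1}|_1^2+|u^k|_1^2)+\frac{h^2}{12}(\|v^{k+1}\|^2+\|v^k\|^2)-\frac{h^4}{144}(|v^{k+1}|_1^2+|v^k|_1^2)\Big]$$ (for $k=0$ the sum over $l$ is empty).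
   Context: Parameters: $\mu,\gamma\ge0$ and $\kappa,\nu$ real constants, $L>0$, $T>0$, and $\varphi:\mathbb R\to\mathbb R$ an $L$-periodic function. $M,N$ are positive integers, $h=L/M$, $\tau=T/N$, $x_i=ih$ ($i\in\mathbb Z$), $t_k=k\tau$. Notation for grid functions: $\delta_xu_{i+1/2}=\frac1h(u_{i+1}-u_i)$, $\delta_x^2u_i=\frac1{h^2}(u_{i+1}-2u_i+u_{i-1})$, $\Delta_xu_i=\frac1{2h}(u_{i+1}-u_{i-1})$, $u^{k+1/2}=\frac12(u^k+u^{k+1})$, $u^{\bar k}=\frac12(u^{k-1}+u^{k+1})$, $\delta_tu^{k+1/2}=\frac1\tau(u^{k+1}-u^k)$, $\Delta_tu^k=\frac1{2\tau}(u^{k+1}-u^{k-1})$, $\psi(u,v)_i=\frac13[u_i\Delta_xv_i+\Delta_x(uv)_i]$. For $M$-periodic grid functions ($u_{i+M}=u_i$): $\|u\|=\big(h\sum_{i=1}^Mu_i^2\big)^{1/2}$, $|u|_1=\big(h\sum_{i=1}^M(\delta_xu_{i-1/2})^2\big)^{1/2}$. Compact difference scheme (for the equation $u_t-\mu u_{xxt}+\gamma uu_x+\kappa u_x-\nu u_{xx}=0$ with $L$-periodic boundary condition and initial value $\varphi$). Real grid functions $u_i^k,v_i^k$ ($0\le k\le N$), $M$-periodic in $i$, with $u_i^0=\varphi(x_i)$ and, for $1\le i\le M$: (1) $\delta_tu_i^{1/2}-\mu\delta_tv_i^{1/2}+\gamma\big[\psi(u^0,u^{1/2})_i-\frac{h^2}2\psi(v^0,u^{1/2})_i\big]+\kappa\big(\Delta_xu_i^{1/2}-\frac{h^2}6\Delta_xv_i^{1/2}\big)-\nu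 v_i^{1/2}=0$; (2) $\Delta_tu_i^k-\mu\Delta_tv_i^k+\gamma\big[\psi(u^k,u^{\bar k})_i-\frac{h^2}2\psi(v^k,u^{\bar k})_i\big]+\kappa\big(\Delta_xu_i^{\bar k}-\frac{h^2}6\Delta_xv_i^{\bar k}\big)-\nu v_i^{\bar k}=0$ for $1\le k\le N-1$; (3) $v_i^k=\delta_x^2u_i^k-\frac{h^2}{12}\delta_x^2v_i^k$ for $0\le k\le N$. *)

(* Defs.v *)
From HB Require Import structures.
From mathcomp Require Import all_boot all_order all_algebra.
From mathcomp Require Import reals trigo.
Set Implicit Arguments.
Unset Strict Implicit.
Unset Printing Implicit Defensive.
Import Order.TTheory GRing.Theory Num.Theory.
Local Open Scope ring_scope.

(* A grid function is a map [int -> R]; a family of time levels is a map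
   [nat -> int -> R], whose level k is the grid function [u k]. *)

(* [diffx h u i] is $\delta_x u_{i+1/2}$; hence $\delta_x u_{i-1/2}$ is
   [diffx h u (i - 1)]. *)
Definition diffx (R : realType) (h : R) (u : int -> R) (i : int) : R :=
  h^-1 * (u (i + 1) - u i).

(* $\delta_x^2 u_i$ *)
Definition diffx2 (R : realType) (h : R) (u : int -> R) (i : int) : R :=
  (h ^+ 2)^-1 * (u (i + 1) - 2 * u i + u (i - 1)).

(* $\Delta_x u_i$ *)
Definition cdiffx (R : realType) (h : R) (u : int -> R) (i : int) : R :=
  (2 * h)^-1 * (u (i + 1) - u (i - 1)).

(* $u^{k+1/2}$ *)
Definition avg_half (R : realType) (u : nat -> int -> R) (k : nat) (i : int)
  : R := 2^-1 * (u k i + u k.+1 i).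

(* $u^{\bar k}$; only meaningful for k >= 1, because of [k.-1]. *)
Definition avg_bar (R : realType) (u : nat -> int -> R) (k : nat) (i : int)
  : R := 2^-1 * (u k.-1 i + u k.+1 i).

(* $\delta_t u_i^{k+1/2}$ *)
Definition difft (R : realType) (tau : R) (u : nat -> int -> R) (k : nat)
  (i : int) : R := tau^-1 * (u k.+1 i - u k i).

(* $\Delta_t u_i^k$; only meaningful for k >= 1, because of [k.-1]. *)
Definition cdifft (R : realType) (tau : R) (u : nat -> int -> R) (k : nat)
  (i : int) : R := (2 * tau)^-1 * (u k.+1 i - u k.-1 i).

Definition psi (R : realType) (h : R) (u v : int -> R) (i : int) : R :=
  3^-1 * (u i * cdiffx h v i + cdiffx h (fun j => u j * v j) i).

(* $\|u\|$ *)
Definition grid_norm (R : realType) (M : nat) (h : R) (u : int -> R) : R :=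
  Num.sqrt (h * \sum_(1 <= i < M.+1) u i%:Z ^+ 2).

(* $|u|_1$ *)
Definition grid_norm1 (R : realType) (M : nat) (h : R) (u : int -> R) : R :=
  Num.sqrt (h * \sum_(1 <= i < M.+1) diffx h u (i%:Z - 1) ^+ 2).

(* Only the time levels 0, ..., N of u and v are constrained. *)
Record compact_scheme (R : realType) (mu gamma kappa nu : R) (phi : R -> R)
  (M N : nat) (h tau : R) (u v : nat -> int -> R) : Prop := CompactScheme {
  scheme_periodic_u : forall k : nat, (k <= N)%N -> periodic (u k) M%:Z;
  scheme_periodic_v : forall k : nat, (k <= N)%N -> periodic (v k) M%:Z;
  scheme_init : forall i : int, u 0%N i = phi (i%:~R * h);
  scheme_first : forall i : int, 1 <= i <= M%:Z ->
    difft tau u 0 i - mu * difft tau v 0 i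
    + gamma * (psi h (u 0%N) (avg_half u 0) i
               - h ^+ 2 / 2 * psi h (v 0%N) (avg_half u 0) i)
    + kappa * (cdiffx h (avg_half u 0) i
               - h ^+ 2 / 6 * cdiffx h (avg_half v 0) i)
    - nu * avg_half v 0 i = 0;
  scheme_step : forall k : nat, (1 <= k <= N.-1)%N ->
    forall i : int, 1 <= i <= M%:Z ->
    cdifft tau u k i - mu * cdifft tau v k i
    + gamma * (psi h (u k) (avg_bar u k) i
               - h ^+ 2 / 2 * psi h (v k) (avg_bar u k) i)
    + kappa * (cdiffx h (avg_bar u k) i
               - h ^+ 2 / 6 * cdiffx h (avg_bar v k) i)
    - nu * avg_bar v k i = 0;
  scheme_compact : forall k : nat, (k <= N)%N ->
    forall i : int, 1 <= i <= M%:Z ->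
    v k i = diffx2 h (u k) i - h ^+ 2 / 12 * diffx2 h (v k) i
}.

(* $E(u^{k+1}, u^k)$; it also depends on v and on the levels below k. *)
Definition energy (R : realType) (mu nu : R) (M : nat) (h tau : R)
  (u v : nat -> int -> R) (k : nat) : R :=
  2^-1 * (grid_norm M h (u k.+1) ^+ 2 + grid_norm M h (u k) ^+ 2)
  + 2 * nu * tau * (\sum_(1 <= l < k.+1)
      (grid_norm1 M h (avg_bar u l) ^+ 2
       + h ^+ 2 / 12 * grid_norm M h (avg_bar v l) ^+ 2
       - h ^+ 4 / 144 * grid_norm1 M h (avg_bar v l) ^+ 2))
  + mu / 2 * ((grid_norm1 M h (u k.+1) ^+ 2 + grid_norm1 M h (u k) ^+ 2)
      + h ^+ 2 / 12 * (grid_norm M h (v k.+1) ^+ 2 + grid_norm M h (v k) ^+ 2)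
      - h ^+ 4 / 144 * (grid_norm1 M h (v k.+1) ^+ 2 + grid_norm1 M h (v k) ^+ 2)).

(* Main.v *)
(** Pair the scheme with the mean w of the two outer time levels. All sums run
    over one period, so the centred difference is skew-adjoint and the second
    difference is self-adjoint: the convection terms vanish, and the time
    difference gives half the increment of the squared norm. The compact relation
    makes the form -(v, w) symmetric in the pairs (u, v) and (w, z), with quadratic
    form |u|_1^2 + h^2/12 |v|^2 - h^4/144 |v|_1^2, so the mu-term also telescopes in
    time. *)

Require Import Defs.
From HB Require Import structures.
From mathcomp Require Import all_boot all_order all_algebra.
From mathcomp Require Import reals trigo.
From mathcomp Require Import ring lra.
Set Implicit Arguments.
Unset Strict Implicit.
Unset Printing Implicit Defensive.
Import Order.TTheory GRing.Theory Num.Theory.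
Local Open Scope ring_scope.

Definition gdot (R : realType) (M : nat) (f g : int -> R) : R :=
  \sum_(1 <= i < M.+1) f i%:Z * g i%:Z.

Definition bdiffx (R : realType) (h : R) (f : int -> R) (i : int) : R :=
  diffx h f (i - 1).

Definition compact_on (R : realType) (M : nat) (h : R) (p q : int -> R) : Prop :=
  forall i : int, 1 <= i <= M%:Z ->
    q i = diffx2 h p i - h ^+ 2 / 12 * diffx2 h q i.

(** Polarisation of [compact_energy], up to the weight [h]: it also carries the mixed terms between
    two time levels. *)
Definition compact_form (R : realType) (M : nat) (h : R) (p q r s : int -> R)
  : R :=
  gdot M (bdiffx h p) (bdiffx h r) + h ^+ 2 / 12 * gdot M q s
  - h ^+ 4 / 144 * gdot M (bdiffx h q) (bdiffx h s).

Definition compact_energy (R : realType) (M : nat) (h : R) (p q : int -> R) : R :=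
  grid_norm1 M h p ^+ 2 + h ^+ 2 / 12 * grid_norm M h q ^+ 2
  - h ^+ 4 / 144 * grid_norm1 M h q ^+ 2.

Section PeriodicSums.
Variables (R : realType) (M : nat) (h : R).
Implicit Types f g p q r s w z : int -> R.

(** Source of all summations by parts below: each identity is reduced to exhibiting a periodic
    discrete primitive [g]. *)
Lemma sum_periodic_diff f g : periodic g M%:Z ->
  (forall i, f i = g (i + 1) - g i) -> \sum_(1 <= i < M.+1) f i%:Z = 0.
Proof.
move=> gM fE.
rewrite (eq_bigr (fun i : nat => g i.+1%:Z - g i%:Z)); last first.
  by move=> i _; rewrite fE -addn1 PoszD.
by rewrite (telescope_sumr (fun i : nat => g i%:Z)) // -add1n PoszD gM subrr.
Qed.

Lemma periodic_shift f (c : int) : periodic f M%:Z -> forall i, f (i + M%:Z + c) = f (i + c).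
Proof. by move=> fM i; rewrite addrAC fM. Qed.

Lemma gdotC f g : gdot M f g = gdot M g f.
Proof. by apply: eq_bigr => i _; rewrite mulrC. Qed.

Lemma eq_gdotl f1 f2 g : (forall i : int, 1 <= i <= M%:Z -> f1 i = f2 i) ->
  gdot M f1 g = gdot M f2 g.
Proof. by move=> ff; apply: eq_big_nat => i /andP[i1 iM]; rewrite ff ?lez_nat ?i1. Qed.

Lemma gdot_cdiffx f g : periodic f M%:Z -> periodic g M%:Z ->
  gdot M (cdiffx h f) g = - gdot M f (cdiffx h g).
Proof.
move=> fM gM; apply/eqP; rewrite -addr_eq0 /gdot -big_split /=; apply/eqP.
apply: (@sum_periodic_diff (fun i => cdiffx h f i * g i + f i * cdiffx h g i)
  (fun i => (2 * h)^-1 * (f i * g (i - 1) + f (i - 1) * g i))) => i.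
  by rewrite !periodic_shift // fM gM.
by rewrite /cdiffx addrK; ring.
Qed.

Lemma gdot_diffx2 f g : periodic f M%:Z -> periodic g M%:Z ->
  gdot M (diffx2 h f) g = - gdot M (bdiffx h f) (bdiffx h g).
Proof.
move=> fM gM; apply/eqP; rewrite -addr_eq0 /gdot -big_split /=; apply/eqP.
apply: (@sum_periodic_diff
  (fun i => diffx2 h f i * g i + bdiffx h f i * bdiffx h g i)
  (fun i => (h ^+ 2)^-1 * ((f i - f (i - 1)) * g (i - 1)))) => i.
  by rewrite !periodic_shift // fM.
by rewrite /diffx2 /bdiffx /diffx !subrK !addrK -exprVn; ring.
Qed.

(** With forward and backward increments f+, f-, g+, g-, the summand is a multiple of (f+ - f-)(g+ +
    g-) + (g+ - g-)(f+ + f-) = 2(f+ g+ - f- g-), which telescopes. *)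
Lemma gdot_diffx2_cdiffx f g : periodic f M%:Z -> periodic g M%:Z ->
  gdot M (diffx2 h f) (cdiffx h g) = - gdot M (diffx2 h g) (cdiffx h f).
Proof.
move=> fM gM; apply/eqP; rewrite -addr_eq0 /gdot -big_split /=; apply/eqP.
apply: (@sum_periodic_diff
  (fun i => diffx2 h f i * cdiffx h g i + diffx2 h g i * cdiffx h f i)
  (fun i => 2 * (h ^+ 2)^-1 * (2 * h)^-1 *
     ((f i - f (i - 1)) * (g i - g (i - 1))))) => i.
  by rewrite !periodic_shift // fM gM.
by rewrite /diffx2 /cdiffx addrK; ring.
Qed.

Lemma gdot_cdiffx_self f : periodic f M%:Z -> gdot M (cdiffx h f) f = 0.
Proof. by move=> fM; have := gdot_cdiffx fM fM; rewrite (gdotC f); lra. Qed.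

(** Multiplication by [f] is symmetric and [cdiffx] is skew, so the two halves of [psi] are opposite
    when paired with [w]. *)
Lemma gdot_psi_self f w : periodic f M%:Z -> periodic w M%:Z ->
  gdot M (psi h f w) w = 0.
Proof.
move=> fM wM.
have fwM : periodic (fun j => f j * w j) M%:Z by move=> i; rewrite fM wM.
rewrite (_ : gdot _ _ _ = 3^-1 * (gdot M (fun j => f j * w j) (cdiffx h w)
    + gdot M (cdiffx h (fun j => f j * w j)) w)).
  by rewrite (gdot_cdiffx fwM wM) subrr mulr0.
by rewrite /gdot -big_split mulr_sumr; apply: eq_bigr => i _ /=; rewrite /psi; ring.
Qed.

Lemma gdot_compact p q g : compact_on M h p q ->
  gdot M q g = gdot M (diffx2 h p) g - h ^+ 2 / 12 * gdot M (diffx2 h q) g.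
Proof.
move=> pq; rewrite (eq_gdotl g pq) /gdot mulr_sumr -sumrB.
by apply: eq_bigr => i _; rewrite mulrBl mulrA.
Qed.

(** Pairing the relation for (p, q) with [r] leaves a mixed term in the differences of [q] and [r];
    pairing the relation for (r, s) with [q] evaluates it. *)
Lemma gdot_compact_form p q r s :
  periodic p M%:Z -> periodic q M%:Z -> periodic r M%:Z -> periodic s M%:Z ->
  compact_on M h p q -> compact_on M h r s ->
  gdot M q r = - compact_form M h p q r s.
Proof.
move=> pM qM rM sM pq rs; have := gdot_compact q rs.
rewrite (gdot_compact r pq) !gdot_diffx2 // (gdotC s q).
rewrite (gdotC (bdiffx h r)) (gdotC (bdiffx h s)) /compact_form.
by move=> ->; field.
Qed.

Lemma gdot_compactC p q r s :
  periodic p M%:Z -> periodic q M%:Z -> periodic r M%:Z -> periodic s M%:Z ->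
  compact_on M h p q -> compact_on M h r s -> gdot M q r = gdot M s p.
Proof.
move=> pM qM rM sM pq rs; rewrite (gdot_compact_form pM _ _ _ pq rs) //.
rewrite (gdot_compact_form rM _ _ _ rs pq) // /compact_form.
by congr (- (_ + _ * _ - _ * _)); apply: gdotC.
Qed.

(* The second difference commutes with the skew centred difference, so by the
   compact relation every term below is a skew form evaluated on the diagonal. *)
Lemma gdot_cdiffx_compact w z : periodic w M%:Z -> periodic z M%:Z ->
  compact_on M h w z -> gdot M (cdiffx h z) w = 0.
Proof.
move=> wM zM wz; rewrite gdot_cdiffx // (gdot_compact _ wz).
have D2D f : periodic f M%:Z -> gdot M (diffx2 h f) (cdiffx h f) = 0.
  by move=> fM; have := gdot_diffx2_cdiffx fM fM; lra.
(* Testing the relation against [cdiffx h z] shows that the one remaining mixed term is zero. *)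
have := gdot_compact (cdiffx h z) wz; rewrite (gdot_diffx2_cdiffx zM wM).
rewrite gdotC gdot_cdiffx_self // !D2D // mulr0 subr0 => <-.
by rewrite oppr0 mulr0 subr0 oppr0.
Qed.

Hypothesis h_ge0 : 0 <= h.

Lemma sqr_grid_norm f : grid_norm M h f ^+ 2 = h * gdot M f f.
Proof. by rewrite sqr_sqrtr // mulr_ge0 // sumr_ge0 // => i _; rewrite sqr_ge0. Qed.

Lemma sqr_grid_norm1 f : grid_norm1 M h f ^+ 2 = h * gdot M (bdiffx h f) (bdiffx h f).
Proof. by rewrite sqr_sqrtr // mulr_ge0 // sumr_ge0 // => i _; rewrite sqr_ge0. Qed.

Lemma compact_energyE p q : compact_energy M h p q = h * compact_form M h p q p q.
Proof.
by rewrite /compact_energy /compact_form !sqr_grid_norm1 sqr_grid_norm; ring.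
Qed.

(** Common form of both time steps: [sigma] is the distance between the outer levels, [tau] at the
    start and [2 * tau] afterwards, and [a], [b] are the level frozen in the convection term. *)
Lemma energy_step (mu gamma kappa nu sigma : R) (a b p0 q0 p1 q1 : int -> R) :
  let w := fun i => 2^-1 * (p0 i + p1 i) in
  let z := fun i => 2^-1 * (q0 i + q1 i) in
  sigma != 0 ->
  periodic a M%:Z -> periodic b M%:Z ->
  periodic p0 M%:Z -> periodic q0 M%:Z -> periodic p1 M%:Z -> periodic q1 M%:Z ->
  compact_on M h p0 q0 -> compact_on M h p1 q1 ->
  (forall i : int, 1 <= i <= M%:Z ->
    sigma^-1 * (p1 i - p0 i) - mu * (sigma^-1 * (q1 i - q0 i))
    + gamma * (psi h a w i - h ^+ 2 / 2 * psi h b w i)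
    + kappa * (cdiffx h w i - h ^+ 2 / 6 * cdiffx h z i)
    - nu * z i = 0) ->
  2^-1 * grid_norm M h p1 ^+ 2 + mu / 2 * compact_energy M h p1 q1
    + sigma * nu * compact_energy M h w z
  = 2^-1 * grid_norm M h p0 ^+ 2 + mu / 2 * compact_energy M h p0 q0.
Proof.
move=> w z s0 aM bM p0M q0M p1M q1M pq0 pq1 scheme.
have wM : periodic w M%:Z by move=> i; rewrite /w p0M p1M.
have zM : periodic z M%:Z by move=> i; rewrite /z q0M q1M.
have wz : compact_on M h w z.
  by move=> i iM; rewrite /w /z {1}pq0 // {1}pq1 // /diffx2; ring.
have lin f : gdot M f w = 2^-1 * (gdot M f p0 + gdot M f p1).
  rewrite /gdot -big_split mulr_sumr; apply: eq_bigr => i _ /=.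
  by rewrite /w; ring.
have := eq_gdotl w scheme.
rewrite {2}/gdot big1 => [|i _]; last by rewrite mul0r.
rewrite (_ : gdot _ _ _ = sigma^-1 * (gdot M p1 w - gdot M p0 w)
   - mu * (sigma^-1 * (gdot M q1 w - gdot M q0 w))
   + gamma * (gdot M (psi h a w) w - h ^+ 2 / 2 * gdot M (psi h b w) w)
   + kappa * (gdot M (cdiffx h w) w - h ^+ 2 / 6 * gdot M (cdiffx h z) w)
   - nu * gdot M z w); last first.
  rewrite /gdot !(mulr_sumr, =^~ sumrB, =^~ big_split) /=.
  by apply: eq_bigr => i _; ring.
rewrite !gdot_psi_self // gdot_cdiffx_self // gdot_cdiffx_compact //.
rewrite (gdot_compact_form wM _ _ _ wz wz) // !lin.
(* By symmetry the cross terms between the two outer levels coincide, hence cancel in the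
   increments. *)
rewrite (gdot_compactC p1M _ _ _ pq1 pq0) // (gdotC p1 p0).
rewrite (gdot_compact_form p0M _ _ _ pq0 pq0) //.
rewrite (gdot_compact_form p1M _ _ _ pq1 pq1) //.
rewrite !compact_energyE !sqr_grid_norm => scheme0.
apply/eqP; rewrite -subr_eq0; apply/eqP.
(* The factor [sigma] clears the time quotient and [h] restores the weight of the grid norms. *)
rewrite -[RHS](mulr0 (sigma * h)) -[in RHS]scheme0.
by field.
Qed.

End PeriodicSums.

Theorem theorem1 (R : realType) (mu gamma kappa nu L T : R) (phi : R -> R)
  (M N : nat) (h tau : R) (u v : nat -> int -> R)
  (hmu : 0 <= mu) (hgamma : 0 <= gamma) (hL : 0 < L) (hT : 0 < T)
  (hphi : periodic phi L) (hM : (0 < M)%N) (hN : (0 < N)%N)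
  (hh : h = L / M%:R) (htau : tau = T / N%:R)
  (huv : compact_scheme mu gamma kappa nu phi M N h tau u v) :
  (2^-1 * (grid_norm M h (u 1%N) ^+ 2 + grid_norm M h (u 0%N) ^+ 2)
   + mu / 2 * ((grid_norm1 M h (u 1%N) ^+ 2 + grid_norm1 M h (u 0%N) ^+ 2)
       + h ^+ 2 / 12 * (grid_norm M h (v 1%N) ^+ 2 + grid_norm M h (v 0%N) ^+ 2)
       - h ^+ 4 / 144 * (grid_norm1 M h (v 1%N) ^+ 2 + grid_norm1 M h (v 0%N) ^+ 2))
   + nu * tau * (grid_norm1 M h (avg_half u 0) ^+ 2
       + h ^+ 2 / 12 * grid_norm M h (avg_half v 0) ^+ 2
       - h ^+ 4 / 144 * grid_norm1 M h (avg_half v 0) ^+ 2)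
   = grid_norm M h (u 0%N) ^+ 2 + mu * grid_norm1 M h (u 0%N) ^+ 2
     + mu * h ^+ 2 / 12 * grid_norm M h (v 0%N) ^+ 2
     - mu * h ^+ 4 / 144 * grid_norm1 M h (v 0%N) ^+ 2)
  /\
  (forall k : nat, (1 <= k <= N.-1)%N ->
     energy mu nu M h tau u v k = energy mu nu M h tau u v 0).

Proof.
case: huv => uM vM _ first step compact.
have h_gt0 : 0 < h by rewrite hh divr_gt0 // ltr0n.
have h_ge0 := ltW h_gt0.
have tau_neq0 : tau != 0 by rewrite htau gt_eqF // divr_gt0 // ltr0n.
have start := energy_step h_ge0 tau_neq0 (uM 0 isT) (vM 0 isT)
  (uM 0 isT) (vM 0 isT) (uM 1 hN) (vM 1 hN) (compact 0 isT) (compact 1 hN) first.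
split.
  by move: start; rewrite /compact_energy /avg_half; lra.
have next k : (1 <= k <= N.-1)%N ->
    energy mu nu M h tau u v k = energy mu nu M h tau u v k.-1.
  case: k => // k kN; have kN1 : (k.+2 <= N)%N by move: kN; case: (N) hN.
  have kN0 := ltnW kN1; have kN' := ltnW kN0.
  have tau2_neq0 : 2 * tau != 0 by rewrite mulf_neq0 // pnatr_eq0.
  have := energy_step h_ge0 tau2_neq0 (uM _ kN0) (vM _ kN0) (uM _ kN') (vM _ kN')
    (uM _ kN1) (vM _ kN1) (compact _ kN') (compact _ kN1) (step _ kN).
  (* The middle level occurs in both energies and cancels; the last summand is the dissipation of
     this step. *)
  rewrite /energy /= big_nat_recr //= /compact_energy /avg_bar /=.
  by set S := \sum_(1 <= l < _) _; lra.
(* Index 1 is treated apart, as the induction hypothesis says nothing at 0. *)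
elim=> // -[|k] IH kN; rewrite next //.
by apply: IH; case/andP: kN => _ /ltnW.
Qed.
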